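(* Let $(G,\Gamma)$ be a weak pseudo-Riemannian structure with Levi-Civita connection on an open subset $\mathcal{N}$ of a Fréchet space $E$, and let $f\in C^{\infty}(\mathcal{N})$ be nowhere zero and admit a $G$-gradient $\operatorname{grad}f$. Then $\widetilde G:=fG$ is again weakly non degenerate and admits the Levi-Civita connection $$\widetilde\Gamma_g(h,k)=\Gamma_g(h,k)-\frac{1}{2f(g)}\Bigl[df(g)(h)\,k+df(g)(k)\,h-G_g(h,k)\,\operatorname{grad}f(g)\Bigr].$$
   Context: Smoothness is in the convenient sense: a map between open subsets of Fréchet spaces is smooth if it sends smooth curves to smooth curves. $L^2_{\mathrm{sym}}(E;F)$ is the space of continuous symmetric bilinear maps $E\times E\to F$; a map from $\mathcal{N}$ into it is smooth when the joint evaluation $\mathcal{N}\times E\times E\to F$ is smooth. A weak pseudo-Riemannian structure with Levi-Civita connection on $\mathcal{N}$ is a pair $(G,\Gamma)$ where $G\colon\mathcal{N}\to L^2_{\mathrm{sym}}(E;\mathbb{R})$ is smooth with each $G_g$ weakly non degenerate ($G_g(h,k)=0$ for all $k\in E$ implies $h=0$), and $\Gamma\colon\mathcal{N}\to L^2_{\mathrm{sym}}(E;E)$ is smooth and satisfies the metricity identity $$DG(g)(l)(h,k)+G_g(\Gamma_g(l,h),k)+G_g(h,\Gamma_g(l,k))=0,\qquad g\in\mathcal{N},\ l,h,k\in E.$$ Such a $\Gamma$ is called the (Christoffel map of the) Levi-Civita connection of $G$; the associated covariant derivative along a curve $c$ is $\nabla_{\partial_t}h=h'-\Gamma_c(c',h)$.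 A function $f\in C^\infty(\mathcal{N})$ admits a $G$-gradient if there is a smooth $\operatorname{grad}f\colon\mathcal{N}\to E$ with $df(g)(h)=G_g(\operatorname{grad}f(g),h)$ for all $g\in\mathcal{N}$, $h\in E$. *)

(* Defs.v *)
From HB Require Import structures.
From mathcomp Require Import all_boot all_order all_algebra sesquilinear.
From mathcomp Require Import all_classical all_reals all_analysis.

Set Implicit Arguments.
Unset Strict Implicit.
Unset Printing Implicit Defensive.

Import Order.TTheory GRing.Theory Num.Theory.
Import numFieldNormedType.Exports.

Local Open Scope classical_set_scope.
Local Open Scope ring_scope.

Section Definitions.
Context {R : realType}.

(* A locally convex space is Frechet when it is Hausdorff, first countable and
   complete. Cauchy sequences are those of the vector space structure: the
   uniform structure of a [tvsType] is only required to induce its topology, not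
   to be translation invariant. *)
Definition frechet_space (E : tvsType R) : Prop :=
  [/\ hausdorff_space E,
      exists U : nat -> set E,
        (forall n, nbhs (0 : E) (U n)) /\
        (forall V, nbhs (0 : E) V -> exists n, U n `<=` V)
    & forall u : nat -> E,
        (forall V, nbhs (0 : E) V ->
           exists n0, forall m n, (n0 <= m)%N -> (n0 <= n)%N -> V (u m - u n)) ->
        exists l : E, u @ \oo --> l].

(* The derivatives of [derive.v] are restricted to normed modules. *)
Definition curve_derivative (E : tvsType R) (c c' : R -> E) : Prop :=
  forall t : R, (fun h : R => h^-1 *: (c (t + h) - c t)) @ 0^' --> c' t.

Definition smooth_curve (E : tvsType R) (c : R -> E) : Prop :=
  exists d : nat -> R -> E,
    d 0%N = c /\ forall n, curve_derivative (d n) (d n.+1).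

(* Maps on a subset [A] of [E] are represented by total functions; their values
   outside of [A] are irrelevant. *)
Definition smooth_on (E F : tvsType R) (A : set E) (f : E -> F) : Prop :=
  forall c : R -> E, smooth_curve c -> (forall t, A (c t)) ->
    smooth_curve (f \o c).

Definition L2sym (E F : tvsType R) (b : E -> E -> F) : Prop :=
  [/\ bilinear_for *:%R *:%R b,
      continuous (fun p : E * E => b p.1 p.2)
    & forall h k, b h k = b k h].

Definition smooth_L2sym (E F : tvsType R) (N : set E) (B : E -> E -> E -> F) :
    Prop :=
  (forall g, N g -> L2sym (B g)) /\
  smooth_on (N `*` [set: E] `*` [set: E])
    (fun p : E * E * E => B p.1.1 p.1.2 p.2).

Definition weakly_nondegenerate (E : tvsType R) (b : E -> E -> R) : Prop :=
  forall h, (forall k, b h k = 0) -> h = 0.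

(* The limit defining this derivative exists whenever [f] is smooth on an open
   neighbourhood of [g]. *)
Definition dir_derive (E : tvsType R) (f : E -> R) (g l : E) : R :=
  derive1 (fun t : R => f (g + t *: l)) 0.

Record weak_pseudo_riemannian (E : tvsType R) (N : set E)
    (G : E -> E -> E -> R) (Gamma : E -> E -> E -> E) : Prop := {
  metric_smooth : smooth_L2sym N (G : E -> E -> E -> R^o) ;
  metric_nondegenerate : forall g, N g -> weakly_nondegenerate (G g) ;
  christoffel_smooth : smooth_L2sym N Gamma ;
  metricity : forall g l h k, N g ->
    dir_derive (fun x => G x h k) g l
      + G g (Gamma g l h) k + G g h (Gamma g l k) = 0
}.

Definition is_gradient (E : tvsType R) (N : set E) (G : E -> E -> E -> R)
    (f : E -> R) (gradf : E -> E) : Prop :=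
  smooth_on N gradf /\
  forall g h, N g -> dir_derive f g h = G g (gradf g) h.

Definition conformal_metric (E : tvsType R) (G : E -> E -> E -> R)
    (f : E -> R) (g h k : E) : R :=
  f g * G g h k.

Definition conformal_christoffel (E : tvsType R) (G : E -> E -> E -> R)
    (Gamma : E -> E -> E -> E) (f : E -> R) (gradf : E -> E) (g h k : E) : E :=
  Gamma g h k - (2 * f g)^-1 *:
    (dir_derive f g h *: k + dir_derive f g k *: h - G g h k *: gradf g).

End Definitions.

(* Main.v *)
Require Import Defs.
From HB Require Import structures.
From mathcomp Require Import all_boot all_order all_algebra.
From mathcomp Require Import all_classical all_reals all_analysis.
From mathcomp Require Import ring lra.

Set Implicit Arguments.
Unset Strict Implicit.
Unset Printing Implicit Defensive.

Import Order.TTheory GRing.Theory Num.Theory.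
Import numFieldNormedType.Exports.

Local Open Scope classical_set_scope.
Local Open Scope ring_scope.

(* The metricity identity for [f G] follows from that of [G] and the Leibniz rule
   along the lines [t |-> g + t *: l]: substituting [df(g)(h) = G_g(grad f(g), h)]
   makes all the terms cancel. This substitution is also what makes the new
   Christoffel map bilinear and continuous, since [df(g)] itself is not known to
   be linear. Smoothness is a matter of closure properties of smooth curves; as
   a smooth curve comes with derivatives of all orders, these are obtained
   coinductively, from classes of curves stable under differentiation. *)

(** * Limits of sums, multiples and opposites in a topological vector space *)

Section TvsLimits.
Context {R : realType} {E : tvsType R} {T : Type} {F : set_system T}
  {FF : Filter F}.

Lemma tvs_cvgD (u v : T -> E) a b :
  u @ F --> a -> v @ F --> b -> (fun x => u x + v x) @ F --> a + b.
Proof. by apply: continuous2_cvg; exact: (add_continuous (a, b)). Qed.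

Lemma tvs_cvgZ (s : T -> R^o) (v : T -> E) (a : R^o) b :
  s @ F --> a -> v @ F --> b -> (fun x => s x *: v x) @ F --> a *: b.
Proof.
apply: (@continuous2_cvg _ _ _ _ _ _ _ _ (fun (k : R^o) (e : E) => k *: e)).
exact: (scale_continuous (a, b)).
Qed.

Lemma tvs_cvgN (u : T -> E) a : u @ F --> a -> (fun x => - u x) @ F --> - a.
Proof. by apply: continuous_cvg; exact: opp_continuous. Qed.

End TvsLimits.

(** * Calculus of smooth curves *)

Section SmoothCurves.
Context {R : realType}.
Implicit Types E F : tvsType R.

(** Choice turns the step into a successor map on the curves satisfying [P]; its iterates supply the
    derivatives of all orders. *)
Lemma smooth_curve_coind E (P : (R -> E) -> Prop) :
  (forall c, P c -> exists2 c', curve_derivative c c' & P c') ->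
  forall c, P c -> smooth_curve c.
Proof.
move=> step c Pc.
have /choice[D HD] (s : {c | P c}) : exists s' : {c | P c},
    curve_derivative (sval s) (sval s').
  by case: s => c0 /step [c' cc' Pc'] /=; exists (exist _ c' Pc').
by exists (fun n => sval (iter n D (exist _ c Pc))); split=> // n; exact: HD.
Qed.

Lemma smooth_curve_derivative E (c : R -> E) : smooth_curve c ->
  exists2 c', curve_derivative c c' & smooth_curve c'.
Proof.
move=> [d [<- dd]]; exists (d 1%N); first exact: dd.
by exists (fun n => d n.+1); split=> // n; exact: dd.
Qed.

(** Writing $c(t+h)$ as $c(t)$ plus $h$ times the difference quotient, the second term tends to
    $0\cdot c'(t)=0$. *)
Lemma curve_derivative_continuous E (c c' : R -> E) t :
  curve_derivative c c' -> (fun h => c (t + h)) @ 0^' --> c t.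
Proof.
move=> /(_ t) cc'.
have h0 : (fun h : R => h : R^o) @ 0^' --> (0 : R^o).
  exact: cvg_within.
rewrite -[X in _ --> X]addr0 -(scale0r (c' t)).
apply: (cvg_trans _ (tvs_cvgD (cvg_cst (c t)) (tvs_cvgZ h0 cc'))).
apply: near_eq_cvg.
near=> h; rewrite scalerA divff ?scale1r 1?addrC ?subrK//.
by near: h; exact: nbhs_dnbhs_neq.
Unshelve. all: by end_near. Qed.

Lemma curve_derivative_cst E (e : E) :
  curve_derivative (fun=> e) (fun=> 0).
Proof. by move=> t; under eq_fun do rewrite subrr scaler0; exact: cvg_cst. Qed.

Lemma curve_derivativeD E (a a' b b' : R -> E) :
  curve_derivative a a' -> curve_derivative b b' ->
  curve_derivative (fun t => a t + b t) (fun t => a' t + b' t).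
Proof.
move=> aa' bb' t.
apply: (cvg_trans _ (tvs_cvgD (aa' t) (bb' t))).
by apply: near_eq_cvg; apply: nearW => h; rewrite -scalerDr opprD addrACA.
Qed.

Lemma curve_derivativeZ E (a a' : R -> R^o) (b b' : R -> E) :
  curve_derivative a a' -> curve_derivative b b' ->
  curve_derivative (fun t => a t *: b t) (fun t => a' t *: b t + a t *: b' t).
Proof.
move=> aa' bb' t.
have bt := curve_derivative_continuous (t := t) bb'.
apply: (cvg_trans _ (tvs_cvgD (tvs_cvgZ (aa' t) bt)
                              (tvs_cvgZ (cvg_cst (a t)) (bb' t)))).
(* The increment of the product splits as $(a(t+h)-a(t))\,b(t+h)+a(t)\,(b(t+h)-b(t))$; the factor
   $b(t+h)$ is why continuity of [b] is needed. *)
apply: near_eq_cvg; apply: nearW => h /=.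
rewrite scalerA [a t * _]mulrC -!scalerA -scalerDr; congr (_ *: _).
by rewrite scalerBl scalerBr addrA subrK.
Qed.

Lemma curve_derivative_pair E F (a a' : R -> E) (b b' : R -> F) :
  curve_derivative a a' -> curve_derivative b b' ->
  curve_derivative (fun t => (a t, b t)) (fun t => (a' t, b' t)).
Proof. by move=> aa' bb' t; apply: cvg_pair; [exact: aa'|exact: bb']. Qed.

Lemma curve_derivative_linear E F (L : {linear E -> F}) (a a' : R -> E) :
  continuous L -> curve_derivative a a' ->
  curve_derivative (L \o a) (L \o a').
Proof.
move=> cL aa' t; apply: (cvg_trans _ (continuous_cvg _ (cL (a' t)) (aa' t))).
by apply: near_eq_cvg; apply: nearW => h; rewrite /= linearZ linearB.
Qed.

Lemma smooth_curve_cst E (e : E) : smooth_curve (fun _ : R => e).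
Proof.
exists (fun n => if n is 0 then fun=> e else fun=> 0); split=> // -[|n];
  exact: curve_derivative_cst.
Qed.

Lemma smooth_curveD E (a b : R -> E) : smooth_curve a -> smooth_curve b ->
  smooth_curve (fun t => a t + b t).
Proof.
move=> [d [<- dd]] [e [<- ee]].
by exists (fun n t => d n t + e n t); split=> // n; exact: curve_derivativeD.
Qed.

Lemma smooth_curve_pair E F (a : R -> E) (b : R -> F) :
  smooth_curve a -> smooth_curve b -> smooth_curve (fun t => (a t, b t)).
Proof.
move=> [d [<- dd]] [e [<- ee]].
by exists (fun n t => (d n t, e n t)); split=> // n;
  exact: curve_derivative_pair.
Qed.

Lemma smooth_curve_linear E F (L : {linear E -> F}) (a : R -> E) :
  continuous L -> smooth_curve a -> smooth_curve (L \o a).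
Proof.
move=> cL [d [<- dd]].
by exists (fun n => L \o d n); split=> // n; exact: curve_derivative_linear.
Qed.

Lemma smooth_curve_fst E F (c : R -> E * F) :
  smooth_curve c -> smooth_curve (fun t => (c t).1).
Proof.
apply: (@smooth_curve_linear (E * F)%type E fst) => p.
exact: cvg_fst.
Qed.

Lemma smooth_curve_snd E F (c : R -> E * F) :
  smooth_curve c -> smooth_curve (fun t => (c t).2).
Proof.
apply: (@smooth_curve_linear (E * F)%type F snd) => p.
exact: cvg_snd.
Qed.

(* Products of smooth curves are not stable under differentiation, but finite
   sums of products are. *)
Inductive leibniz_span E : (R -> E) -> Prop :=
| LeibnizScale (a : R -> R^o) (b : R -> E) :
    smooth_curve a -> smooth_curve b -> leibniz_span (fun t => a t *: b t)
| LeibnizAdd (u v : R -> E) :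
    leibniz_span u -> leibniz_span v -> leibniz_span (fun t => u t + v t).

Lemma smooth_curveZ E (a : R -> R^o) (b : R -> E) :
  smooth_curve a -> smooth_curve b -> smooth_curve (fun t => a t *: b t).
Proof.
move=> sa sb; apply: (@smooth_curve_coind _ (@leibniz_span E)); last first.
  exact: LeibnizScale.
move=> c; elim=> {a b sa sb c}.
- move=> a b sa sb.
  have [a' aa' sa'] := smooth_curve_derivative sa.
  have [b' bb' sb'] := smooth_curve_derivative sb.
  exists (fun t => a' t *: b t + a t *: b' t).
    exact: curve_derivativeZ.
  by apply: LeibnizAdd; exact: LeibnizScale.
- move=> u v _ [u' uu' su'] _ [v' vv' sv'].
  exists (fun t => u' t + v' t); first exact: curve_derivativeD.
  exact: LeibnizAdd.
Qed.

Lemma smooth_curveN E (a : R -> E) :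
  smooth_curve a -> smooth_curve (fun t => - a t).
Proof.
move=> sa; under eq_fun do rewrite -scaleN1r.
exact: (smooth_curveZ (smooth_curve_cst (-1 : R^o))).
Qed.

(** For real curves this gives access to the rules for [is_derive]: inverses, powers and
    trigonometric functions. *)
Lemma curve_derivativeP (c c' : R -> R^o) :
  curve_derivative c c' <-> forall t : R, is_derive t (1 : R) c (c' t).
Proof.
have eqq t : (fun h : R => h^-1 *: (c (t + h) - c t)) =
    (fun h : R => h^-1 *: ((c \o shift t) (h *: (1 : R^o)) - c t)).
  by apply/funext => h /=; rewrite /shift/= scaler1 [h + t]addrC.
split=> H t.
- have := H t; rewrite eqq => ct.
  by apply: DeriveDef; [apply/cvg_ex; exists (c' t)|exact: cvg_lim].
- by rewrite eqq; have [/[swap] <-] := H t.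
Qed.

Lemma smooth_curveV (u : R -> R^o) : (forall t, u t != 0) ->
  smooth_curve u -> smooth_curve (fun t => (u t)^-1 : R^o).
Proof.
move=> u0 su.
have [u' /curve_derivativeP uu' su'] := smooth_curve_derivative su.
(* The curves [a / u ^+ n] are stable under differentiation. *)
apply: (@smooth_curve_coind _ (fun c => exists (n : nat) (a : R -> R^o),
  smooth_curve a /\ c = fun t => a t / u t ^+ n)); last first.
  exists 1%N, (fun=> 1); split; first exact: smooth_curve_cst.
  by apply/funext => t; rewrite div1r.
move=> _ [n [a [sa ->]]].
have [a' /curve_derivativeP aa' sa'] := smooth_curve_derivative sa.
(* Numerator given by the quotient rule: $(a/u^n)'=(u a'-n a u')/u^{n+1}$. *)
pose b t : R^o := u t *: a' t + - ((n%:R : R^o) *: (a t *: u' t)).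
exists (fun t => b t / u t ^+ n.+1).
  apply/curve_derivativeP => t.
  have unE x : (u ^+ n) x = u x ^+ n by rewrite fctE.
  have un0 : (u ^+ n) t != 0 by rewrite unE expf_neq0.
  have -> : (fun x => a x / u x ^+ n) = a * (fun x => ((u ^+ n) x)^-1).
    by apply/funext => x; rewrite -unE.
  have H1 := is_deriveV un0 (is_deriveX n (uu' t)).
  have H2 := is_deriveM (aa' t) H1.
  apply: is_derive_eq; rewrite /b unE /GRing.scale/=.
  move: (u t) (u0 t) (u' t) (a t) (a' t) => x x0 x' y y'.
  (* The derivative of $u^n$ carries the truncated exponent [n.-1], so $n=0$ is treated apart. *)
  case: n {b unE un0 H1 H2} => [|n] /=.
    by field.
  rewrite !exprS; move: (x ^+ n) (expf_neq0 n x0) n.+1%:R => z z0 m.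
  by field; apply/andP.
exists n.+1, b; split=> //.
apply: smooth_curveD; first exact: smooth_curveZ.
apply: smooth_curveN; apply: smooth_curveZ; first exact: smooth_curve_cst.
exact: smooth_curveZ.
Qed.

(** The combinations of [sin] and [cos] with constant coefficients are stable under
    differentiation. *)
Lemma smooth_curve_sin : smooth_curve (@sin R : R -> R^o).
Proof.
apply: (@smooth_curve_coind _ (fun c => exists a b : R,
  c = fun t => a * sin t + b * cos t)); last first.
  by exists 1, 0; apply/funext => t; rewrite mul1r mul0r addr0.
move=> _ [a [b ->]].
exists (fun t => (- b) * sin t + a * cos t); last by exists (- b), a.
apply/curve_derivativeP => t.
apply: is_derive_eq.
rewrite /GRing.scale/=; ring.
Qed.

End SmoothCurves.

(** * Directional derivatives and joint smoothness, tested along curves *)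

Section SmoothMaps.
Context {R : realType} {E : tvsType R}.

Lemma smooth_on_line_derivable (N : set E) (f : E -> R) (g l : E) :
  open N -> smooth_on N (f : E -> R^o) -> N g ->
  derivable (fun t : R => f (g + t *: l)) (0 : R) (1 : R).
Proof.
move=> oN sf Ng.
have line_cvg : (fun t : R => g + t *: l) @ (0 : R) --> g.
  rewrite -[X in _ --> X]addr0 -(scale0r l).
  apply: tvs_cvgD; first exact: cvg_cst.
  apply: (@tvs_cvgZ _ _ _ _ _ (fun t : R => t : R^o)); last exact: cvg_cst.
  exact: cvg_id.
have /nbhs_ballP[e /= e0 eN] := line_cvg _ (open_nbhs_nbhs (conj oN Ng)).
(* [smooth_on] only tests curves that never leave [N]: bend the line into a
   bounded arc with [sin], and recover its germ at 0 with [asin]. *)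
have e20 : 0 < e / 2 by rewrite divr_gt0.
pose c (t : R) : E := g + (e / 2 * sin t : R^o) *: l.
have sc : smooth_curve c.
  apply: smooth_curveD; first exact: smooth_curve_cst.
  apply: smooth_curveZ; last exact: smooth_curve_cst.
  apply: (smooth_curveZ (smooth_curve_cst (e / 2 : R^o))).
  exact: smooth_curve_sin.
have Nc t : N (c t).
  apply: eN; rewrite /ball/= sub0r normrN normrM gtr0_norm//.
  have : `|sin t| <= 1 by rewrite ler_norml sin_geN1 sin_le1.
  by nra.
have [fc' /curve_derivativeP Dfc _] := smooth_curve_derivative (sf c sc Nc).
(* Near $0$, $f(g+tl)=(f\circ c)(\arcsin(s(t)))$, and the chain rule applies to the right-hand
   side. *)
pose s (t : R) : R := (e / 2)^-1 * t.
have Ds : is_derive (0 : R) (1 : R) s (e / 2)^-1.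
  by apply: is_derive_eq; rewrite /GRing.scale/=; ring.
have Das : is_derive (s 0) (1 : R) (@asin R) (Num.sqrt (1 - (s 0) ^+ 2))^-1.
  by apply: is_derive1_asin; rewrite /s mulr0 ltrN10 ltr01.
have Df := is_derive1_comp (Dfc (asin (s 0))) (is_derive1_comp Das Ds).
apply: (near_eq_derivable _ (@ex_derive _ _ _ _ _ _ _ Df)).
(* For $|t|<e/2$ the point [s t] lies in $[-1,1]$, where [sin] undoes [asin]. *)
near=> t; rewrite /= /c asinK /s.
  by rewrite mulVKf ?gt_eqF.
have : `|t| < e / 2 by near: t; exact: (@nbhs0_lt R R).
rewrite in_itv/= -ler_norml normrM gtr0_norm ?invr_gt0// => /ltW te.
by rewrite mulrC ler_pdivrMr// mul1r.
Unshelve. all: by end_near. Qed.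

Lemma dir_deriveM (N : set E) (p q : E -> R) (g l : E) :
  open N -> smooth_on N (p : E -> R^o) -> smooth_on N (q : E -> R^o) -> N g ->
  dir_derive (fun x => p x * q x) g l =
    dir_derive p g l * q g + p g * dir_derive q g l.
Proof.
move=> oN sp sq Ng; rewrite /dir_derive !derive1E.
have := deriveM (smooth_on_line_derivable (l := l) oN sp Ng)
                (smooth_on_line_derivable (l := l) oN sq Ng).
by rewrite scale0r addr0 /GRing.scale/= => ->; rewrite addrC mulrC.
Qed.

Lemma smooth_L2sym_curve (F : tvsType R) (N : set E) (B : E -> E -> E -> F)
    (x y z : R -> E) : smooth_L2sym N B ->
  smooth_curve x -> smooth_curve y -> smooth_curve z -> (forall t, N (x t)) ->
  smooth_curve (fun t => B (x t) (y t) (z t)).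
Proof.
move=> [_ sB] sx sy sz Nx.
apply: (sB (fun t => (x t, y t, z t))); last by move=> t; do 2!split=> //=.
exact: (smooth_curve_pair (smooth_curve_pair sx sy) sz).
Qed.

(** A smooth curve in the product has smooth components, so joint smoothness can be checked on
    triples of curves. *)
Lemma smooth_L2sym_of_curves (F : tvsType R) (N : set E) (B : E -> E -> E -> F) :
  (forall g, N g -> L2sym (B g)) ->
  (forall x y z : R -> E,
     smooth_curve x -> smooth_curve y -> smooth_curve z ->
     (forall t, N (x t)) -> smooth_curve (fun t => B (x t) (y t) (z t))) ->
  smooth_L2sym N B.
Proof.
move=> LB sB; split=> // c sc Nc.
have s1 := smooth_curve_fst sc.
apply: (sB (fun t => (c t).1.1) (fun t => (c t).1.2) (fun t => (c t).2)).
- exact: smooth_curve_fst.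
- exact: smooth_curve_snd.
- exact: smooth_curve_snd.
- by move=> t; have [[]] := Nc t.
Qed.

End SmoothMaps.

(** * The conformal metric and its Christoffel map *)

Section Conformal.
Context {R : realType} {E : tvsType R} {N : set E}.
Context {G : E -> E -> E -> R} {Gamma : E -> E -> E -> E}.
Context (hG : weak_pseudo_riemannian N G Gamma).
Context {f : E -> R} {gradf : E -> E}.
Context (hf : smooth_on N (f : E -> R^o)).
Context (hgrad : is_gradient N G f gradf).

Let G_L2sym g : N g -> L2sym (G g : E -> E -> R^o).
Proof. by case: (metric_smooth hG) => + _; exact. Qed.

Lemma metricDl g h h' k : N g -> G g (h + h') k = G g h k + G g h' k.
Proof.
by move=> /G_L2sym[[Gl _] _ _]; have := Gl k 1 h h'; rewrite /= !scale1r.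
Qed.

Lemma metricZl g a h k : N g -> G g (a *: h) k = a * G g h k.
Proof.
move=> Ng; have [[Gl _] _ _] := G_L2sym Ng.
have G0 : G g 0 k = 0.
  by have := metricDl 0 0 k Ng; rewrite addr0 -[LHS]addr0 => /addrI <-.
by have := Gl k a h 0; rewrite /= addr0 G0 addr0.
Qed.

Lemma metricC g h k : N g -> G g h k = G g k h.
Proof. by move=> /G_L2sym[_ _]; exact. Qed.

Lemma metricDr g h k k' : N g -> G g h (k + k') = G g h k + G g h k'.
Proof. by move=> Ng; rewrite metricC// metricDl// !(metricC h). Qed.

Lemma metricZr g a h k : N g -> G g h (a *: k) = a * G g h k.
Proof. by move=> Ng; rewrite metricC// metricZl// !(metricC h). Qed.

Lemma metricNl g h k : N g -> G g (- h) k = - G g h k.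
Proof. by move=> Ng; rewrite -scaleN1r metricZl// mulN1r. Qed.

Lemma metricNr g h k : N g -> G g h (- k) = - G g h k.
Proof. by move=> Ng; rewrite metricC// metricNl// (metricC h). Qed.

Lemma smooth_conformal_metric :
  smooth_L2sym N (conformal_metric G f : E -> E -> E -> R^o).
Proof.
apply: smooth_L2sym_of_curves.
  move=> g Ng; have [_ cG _] := G_L2sym Ng; split.
  - split=> [u a v w|u a v w] /=; rewrite /conformal_metric /GRing.scale/=.
      by rewrite metricDl// metricZl//; ring.
    by rewrite metricDr// metricZr//; ring.
  - move=> p.
    apply: (@tvs_cvgZ _ R^o _ _ _ (fun=> f g : R^o)); first exact: cvg_cst.
    exact: cG.
  - by move=> h k; rewrite /conformal_metric metricC.
move=> x y z sx sy sz Nx.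
apply: (smooth_curveZ (hf sx Nx)).
exact: (smooth_L2sym_curve (metric_smooth hG)).
Qed.

Context (hf0 : forall g, N g -> f g != 0).

Lemma conformal_christoffelE g h k : N g ->
  conformal_christoffel G Gamma f gradf g h k =
  Gamma g h k - (2 * f g)^-1 *:
    (G g (gradf g) h *: k + G g (gradf g) k *: h - G g h k *: gradf g).
Proof. by move=> Ng; rewrite /conformal_christoffel !hgrad.2. Qed.

Lemma smooth_conformal_christoffel :
  smooth_L2sym N (conformal_christoffel G Gamma f gradf).
Proof.
have [GammaL _] := christoffel_smooth hG.
apply: smooth_L2sym_of_curves.
  move=> g Ng; have [_ cG _] := G_L2sym Ng.
  have [[Gammal _] cGamma GammaC] := GammaL g Ng.
  (* Symmetry comes first, so that linearity has to be checked in one slot only. *)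
  have sym h k : conformal_christoffel G Gamma f gradf g h k =
      conformal_christoffel G Gamma f gradf g k h.
    rewrite !conformal_christoffelE// GammaC (metricC h)//.
    by congr (_ - _ *: (_ - _)); exact: addrC.
  split=> //.
  - have lin_l u :
        linear (fun v => conformal_christoffel G Gamma f gradf g v u).
      move=> a v w; rewrite !conformal_christoffelE//.
      rewrite (Gammal u a v w)/=.
      rewrite !metricDl// !metricDr// !metricZl// !metricZr//.
      set s := (2 * f g)^-1; set X := gradf g.
      (* Gathers the scalar combination so that the $\Gamma$ terms agree and only the brackets
         remain to be compared. *)
      have dist (p q V W : E) :
          a *: p + q - s *: (a *: V + W) = a *: (p - s *: V) + (q - s *: W).
        by rewrite scalerDr opprD addrACA scalerBr !scalerA mulrC.
      rewrite -dist; congr (_ - _ *: _).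
      rewrite !scalerDl !scalerDr scalerN !scalerA [G g X u * a]mulrC.
      by rewrite opprD [in RHS]addrACA; congr (_ + _); rewrite addrACA.
    split=> // u a v w /=.
    by rewrite !(sym u) lin_l.
  - move=> p; rewrite /continuous_at.
    under eq_fun do rewrite conformal_christoffelE//.
    rewrite conformal_christoffelE//.
    (* Freezing the first argument of the jointly continuous $G_g$ at the gradient gives continuity
       of the coefficients that replace $df$. *)
    have cGr (q : E * E -> E) : q @ p --> q p ->
        (fun x => G g (gradf g) (q x) : R^o) @ p -->
        (G g (gradf g) (q p) : R^o).
      move=> cq.
      apply: (@continuous2_cvg _ _ _ _ _ _ _ _ (G g : E -> E -> R^o)).
      + exact: (cG (gradf g, q p)).
      + exact: cvg_cst.
      + exact: cq.
    apply: tvs_cvgD; first exact: cGamma.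
    apply: tvs_cvgN; apply: (@tvs_cvgZ _ _ _ _ _ (fun=> _)).
      exact: cvg_cst.
    apply: tvs_cvgD; last first.
      by apply: tvs_cvgN; apply: tvs_cvgZ; [exact: cG|exact: cvg_cst].
    have fst_cvg : @fst E E @ p --> p.1 by exact: cvg_fst.
    have snd_cvg : @snd E E @ p --> p.2 by exact: cvg_snd.
    by apply: tvs_cvgD; apply: tvs_cvgZ; rewrite //; exact: cGr.
move=> x y z sx sy sz Nx.
under eq_fun do rewrite conformal_christoffelE//.
have sG := smooth_L2sym_curve (metric_smooth hG).
have sgrad := hgrad.1 x sx Nx.
apply: smooth_curveD.
  exact: (smooth_L2sym_curve (christoffel_smooth hG)).
apply: smooth_curveN.
apply: (@smooth_curveZ _ _ (fun t => (2 * f (x t))^-1 : R^o)).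
  apply: smooth_curveV; first by move=> t; rewrite mulf_neq0// hf0.
  exact: (smooth_curveZ (smooth_curve_cst (2 : R^o)) (hf sx Nx)).
apply: smooth_curveD.
  by apply: smooth_curveD; apply: smooth_curveZ => //; exact: sG.
by apply: smooth_curveN; apply: smooth_curveZ => //; exact: sG.
Qed.

(** With $X=\operatorname{grad}f(g)$, each Christoffel correction contributes $-\frac12
    G_g(X,l)G_g(h,k)$, and together these cancel the Leibniz term $df(g)(l)\,G_g(h,k)$. The cross
    terms $G_g(X,h)G_g(l,k)$ and $G_g(X,k)G_g(l,h)$ occur with opposite signs in the two
    corrections. *)
Lemma conformal_metricity g l h k : open N -> N g ->
  dir_derive (fun x => conformal_metric G f x h k) g l
    + conformal_metric G f g (conformal_christoffel G Gamma f gradf g l h) k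
    + conformal_metric G f g h (conformal_christoffel G Gamma f gradf g l k)
  = 0.
Proof.
move=> oN Ng; rewrite /conformal_metric.
have sG : smooth_on N (fun x => G x h k : R^o).
  move=> c sc Nc; apply: (smooth_L2sym_curve (metric_smooth hG)) => //;
    exact: smooth_curve_cst.
rewrite (dir_deriveM l oN hf sG Ng) !conformal_christoffelE// hgrad.2//.
(* Metricity of $G$ eliminates $DG(g)(l)(h,k)$, leaving an algebraic identity in values of $G_g$. *)
have /eqP := metricity hG l h k Ng.
rewrite -addrA addr_eq0 => /eqP ->.
rewrite !(metricDl, metricDr, metricNl, metricNr, metricZl, metricZr)//.
(* Equal values of $G_g$ are given the same argument order, so that [field] sees them as one
   atom. *)
rewrite ?(metricC h l)// ?(metricC h (gradf g))//.
by field; rewrite hf0.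
Qed.

End Conformal.

Theorem lemma6p1 (R : realType) (E : tvsType R) (hE : frechet_space E)
    (N : set E) (hN : open N)
    (G : E -> E -> E -> R) (Gamma : E -> E -> E -> E)
    (hG : weak_pseudo_riemannian N G Gamma)
    (f : E -> R) (hf : smooth_on N (f : E -> R^o))
    (hf0 : forall g, N g -> f g != 0)
    (gradf : E -> E) (hgrad : is_gradient N G f gradf) :
  (forall g, N g -> weakly_nondegenerate (conformal_metric G f g)) /\
  weak_pseudo_riemannian N (conformal_metric G f)
    (conformal_christoffel G Gamma f gradf).
Proof.
have nondeg g : N g -> weakly_nondegenerate (conformal_metric G f g).
  move=> Ng h fG0; apply: (metric_nondegenerate hG Ng) => k.
  (* The nonzero scalar $f(g)$ cancels, leaving $G_g(h,k)=0$. *)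
  have /eqP := fG0 k.
  by rewrite /conformal_metric mulf_eq0 (negPf (hf0 g Ng)) => /eqP.
split=> //; split=> //.
- exact: (smooth_conformal_metric hG hf).
- exact: (smooth_conformal_christoffel hG hf hgrad hf0).
- by move=> g l h k Ng; exact: (conformal_metricity hG).
Qed.
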